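(* Let $n\ge 2$ and let $R$ be any $n\times n$ entrywise nonnegative real matrix. Then \[ \frac{1}{15}\cdot\frac{\Delta(R)}{n}\;\le\;\phi(R)\;\le\;\sqrt{2\cdot\Delta(R)}, \] where $\Delta(R)$ and $\phi(R)$ are the spectral gap and edge expansion defined in the context.
   Context: Irreducible: a nonnegative matrix $H$ is irreducible if for every pair $(s,t)$ there is $k>0$ with $(H^k)_{s,t}>0$. By the Perron–Frobenius theorem an irreducible nonnegative $H$ has a simple positive eigenvalue $\lambda_1(H)$ (the PF eigenvalue) with entrywise positive left and right eigenvectors $u$ and $v$ ($H^Tu=\lambda_1 u$, $Hv=\lambda_1 v$), and all other eigenvalues have real part $<\lambda_1(H)$. For irreducible nonnegative $H$, list its eigenvalues (roots of $\det(\lambda I-H)=0$, with multiplicity) as $\lambda_1(H)>\operatorname{Re}\lambda_2(H)\ge\cdots\ge\operatorname{Re}\lambda_n(H)$, and define the spectral gap $\Delta(H)=1-\operatorname{Re}\lambda_2(H)/\lambda_1(H)$. For irreducible nonnegative $H$ with positive PF left/right eigenvectors $u,v$, $D_u,D_v$ the diagonal matrices with $u$, $v$ on the diagonal, and $\mathbf 1_S$ the indicator vector of $S\subseteq[n]$, define for nonempty $S$ \[ \phi_S(H)=\frac{\langle \mathbf 1_S, D_uHD_v\mathbf 1_{\overline S}\rangle}{\langle \mathbf 1_S, D_uHD_v\mathbf 1\rangle},\qquad \phi(H)=\min_{\emptyset\ne S\subseteq[n]:\ \sum_{i\in S}u_iv_i\le\frac12\sum_i u_iv_i}\phi_S(H).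 \] For an arbitrary nonnegative $R$, let $R_\epsilon$ be the set of irreducible nonnegative $H$ with $\|R-H\|_F\le\epsilon$ (Frobenius norm) and define $\Delta(R)=\lim_{\epsilon\to0}\inf_{H\in R_\epsilon}\Delta(H)$ and $\phi(R)=\lim_{\epsilon\to0}\inf_{H\in R_\epsilon}\phi(H)$. *)

(* Defs.v *)
From HB Require Import structures.
From mathcomp Require Import all_boot all_order all_algebra.
From mathcomp Require Import all_classical all_reals.
From mathcomp Require Import topology normedtype.
From mathcomp Require Import complex.
Set Implicit Arguments. Unset Strict Implicit. Unset Printing Implicit Defensive.
Import Order.TTheory GRing.Theory Num.Theory.
Import numFieldTopology.Exports numFieldNormedType.Exports.
Local Open Scope classical_set_scope.
Local Open Scope ring_scope.

Section PFDefs.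
Variables (R : realType) (n : nat).
Implicit Types (A H : 'M[R]_n).

Definition nonneg_mx A := forall i j, 0 <= A i j.

Definition irreducible_mx H :=
  nonneg_mx H /\ forall s t : 'I_n, exists k : nat, (0 < k)%N /\ 0 < (H ^+ k) s t.

Definition char_polyC H : {poly R[i]} :=
  char_poly (map_mx (fun x : R => (x%:C)%C) H).

Definition eigenvalueC H (z : R[i]) : bool := root (char_polyC H) z.

Definition is_pf_eig H (r : R) : Prop :=
  [/\ 0 < r,
      eigenvalueC H (r%:C)%C,
      ~~ ((('X - ((r%:C)%C)%:P) ^+ 2) %| char_polyC H),
      (exists v : 'cV[R]_n, (forall i, 0 < v i 0) /\ H *m v = r *: v) &
      (exists u : 'cV[R]_n, (forall i, 0 < u i 0) /\ H^T *m u = r *: u)].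

Definition pf_eig H : R := xget 0 (is_pf_eig H).

Definition pf_right H : 'cV[R]_n :=
  xget 0 [set v : 'cV[R]_n | (forall i, 0 < v i 0) /\ H *m v = pf_eig H *: v].
Definition pf_left H : 'cV[R]_n :=
  xget 0 [set u : 'cV[R]_n | (forall i, 0 < u i 0) /\ H^T *m u = pf_eig H *: u].

Definition re_lambda2 H : R :=
  sup [set complex.Re z | z in [set z : R[i] | eigenvalueC H z /\ z <> ((pf_eig H)%:C)%C]].

Definition spectral_gap H : R := 1 - re_lambda2 H / pf_eig H.

(* phi_S(H) = <1_S, D_u H D_v 1_{\bar S}> / <1_S, D_u H D_v 1> *)
Definition phi_S H (S : {set 'I_n}) : R :=
  let u := pf_left H in let v := pf_right H in
  (\sum_(i in S) \sum_(j in ~: S) u i 0 * H i j * v j 0) /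
  (\sum_(i in S) \sum_j u i 0 * H i j * v j 0).

Definition edge_expansion H : R :=
  let u := pf_left H in let v := pf_right H in
  inf [set phi_S H S | S in
        [set S : {set 'I_n} | S != finset.set0 /\
           \sum_(i in S) u i 0 * v i 0 <= 2^-1 * \sum_i u i 0 * v i 0]].

Definition frob_norm A : R := Num.sqrt (\sum_i \sum_j (A i j) ^+ 2).

Definition nbhd_irr A (eps : R) : set 'M[R]_n :=
  [set H | irreducible_mx H /\ frob_norm (A - H) <= eps].

Definition spectral_gap_ext A : R :=
  lim ((fun eps : R => inf [set spectral_gap H | H in nbhd_irr A eps]) @ 0^'+).

Definition edge_expansion_ext A : R :=
  lim ((fun eps : R => inf [set edge_expansion H | H in nbhd_irr A eps]) @ 0^'+).

End PFDefs.

(* Main.v *)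
(* With u, v the Perron vectors of an irreducible H and r its Perron root, the
   flow q_ij = u_i H_ij v_j / r has row and column sums p_i = u_i v_i, and phi_S is
   the fraction of the mass p(S) that flows out of S. It suffices to compare the
   gap D and phi for irreducible H, as both extensions are limits of infima over
   shrinking neighbourhoods.

   Upper bound: an eigenvector w for z <> r gives a mean-zero function f = w / u of
   Dirichlet energy (1 - Re z / r) |f|^2, to which Cheeger's argument applies (cut f
   at a median, then the co-area formula and AM-GM).

   Lower bound: let P = q / p and let K = (1 + s (1 - P))^-1, a stochastic matrix with
   stationary measure p. The K-flow out of S is at most s times the q-flow. Since
   p K has a positive semidefinite symmetric part, the K-mass staying inside S and
   inside its complement is controlled by the trace, whence
   2 - tr K <= 2 s phi_S. On the other hand tr K is the sum of
   1 / (1 + s (1 - z / r)) over the spectrum, at most 1 + (n - 1) / (1 + s D); with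
   s = 2 (n - 1) / D this yields phi_S >= D / (8 (n - 1)). *)
Require Import Defs.
From HB Require Import structures.
From mathcomp Require Import all_boot all_order all_algebra.
From mathcomp Require Import all_classical all_reals.
From mathcomp Require Import topology normedtype realfun derive.
From mathcomp Require Import complex polyrcf.
From mathcomp Require Import ring lra.
Set Implicit Arguments. Unset Strict Implicit. Unset Printing Implicit Defensive.
Import Order.TTheory GRing.Theory Num.Theory.
Import numFieldTopology.Exports numFieldNormedType.Exports.
Local Open Scope ring_scope.

(** * Flows with equal row and column sums *)

Section Flow.
Variables (R : realFieldType) (I : finType) (q : I -> I -> R) (p : I -> R).
Hypothesis q_ge0 : forall i j, 0 <= q i j.
Hypothesis q_row : forall i, \sum_j q i j = p i.
Hypothesis q_col : forall j, \sum_i q i j = p j.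

Lemma flow_weight_ge0 i : 0 <= p i.
Proof. by rewrite -q_row sumr_ge0. Qed.

Definition dirichlet (f : I -> R) : R :=
  2^-1 * \sum_i \sum_j q i j * (f i - f j) ^+ 2.

Lemma dirichlet_ge0 f : 0 <= dirichlet f.
Proof.
rewrite mulr_ge0 ?invr_ge0 ?ler0n// sumr_ge0// => i _.
by rewrite sumr_ge0// => j _; rewrite mulr_ge0 ?sqr_ge0.
Qed.

Lemma flow_sum_row (g : I -> R) : \sum_i \sum_j q i j * g i = \sum_i p i * g i.
Proof. by apply: eq_bigr => i _; rewrite -mulr_suml q_row. Qed.

Lemma flow_sum_col (g : I -> R) : \sum_i \sum_j q i j * g j = \sum_i p i * g i.
Proof.
by rewrite exchange_big; apply: eq_bigr => i _; rewrite -mulr_suml q_col.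
Qed.

(** Expanding the square leaves [f i ^+ 2] summed by rows and [f j ^+ 2] summed by columns; both
    give the weight [p]. *)
Lemma dirichletE f :
  dirichlet f = \sum_i p i * f i ^+ 2 - \sum_i \sum_j q i j * (f i * f j).
Proof.
have -> : dirichlet f = 2^-1 * (\sum_i \sum_j q i j * f i ^+ 2
   + \sum_i \sum_j q i j * f j ^+ 2) - \sum_i \sum_j q i j * (f i * f j).
  rewrite /dirichlet -big_split /= mulr_sumr mulr_sumr -sumrB.
  apply: eq_bigr => i _; rewrite -big_split /= !mulr_sumr -sumrB.
  by apply: eq_bigr => j _; field.
by rewrite (flow_sum_row (fun i => f i ^+ 2)) (flow_sum_col (fun i => f i ^+ 2)); field.
Qed.

(* Peeling off the lowest positive level of [h] shrinks its support: an
   inductive form of the layer-cake formula. *)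
Lemma coarea_le (c : R) (S0 : {set I})
    (expS0 : forall S : {set I}, S != finset.set0 -> S \subset S0 ->
       c * \sum_(i in S) p i <= \sum_(i in S) \sum_(j in ~: S) q i j)
    (h : I -> R) :
  (forall i, 0 <= h i) -> (forall i, i \notin S0 -> h i = 0) ->
  c * \sum_i p i * h i <= \sum_i \sum_j q i j * Num.max (h i - h j) 0.
Proof.
have [m] := ubnP #|[set i | 0 < h i]|; elim: m h => // m IH h.
set S := [set i | 0 < h i] => leSm h_ge0 hS0.
have hN i : i \notin S -> h i = 0.
  by rewrite inE -leNgt => hi; apply/le_anti; rewrite hi h_ge0.
have [S_eq0|[i0 i0S]] := set_0Vmem S.
  rewrite big1 ?mulr0 => [|i _]; last by rewrite hN ?mulr0 ?S_eq0 ?inE.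
  rewrite sumr_ge0// => i _; rewrite sumr_ge0// => j _.
  by rewrite mulr_ge0// le_max lexx orbT.
case: (@arg_minP _ _ _ i0 (mem S) h i0S) => k kS k_min; change (is_true (k \in S)) in kS.
set a := h k.
have a_gt0 : 0 < a by move: kS; rewrite inE.
pose g i := h i - a * (i \in S)%:R.
have gE i : i \in S -> g i = h i - a by move=> iS; rewrite /g iS mulr1.
have gN i : i \notin S -> g i = 0 by move=> iS; rewrite /g hN// (negPf iS) mulr0 subr0.
have g_ge0 i : 0 <= g i.
  by have [iS|iS] := boolP (i \in S); [rewrite gE// subr_ge0 k_min|rewrite gN].
have gS0 i : i \notin S0 -> g i = 0.
  by move=> /hS0 hi; rewrite gN// inE hi ltxx.
have ltg : (#|[set i | (0 < g i)%R]| < m)%N.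
  rewrite -ltnS (leq_trans _ leSm)// ltnS proper_card//; apply/properP; split.
    by apply/fintype.subsetP => i; rewrite inE; apply: contraTT => /gN ->; rewrite ltxx.
  by exists k => //; rewrite inE gE// subrr ltxx.
have := IH g ltg g_ge0 gS0.
have /(expS0 S) : S != finset.set0 by apply/set0Pn; exists i0.
have SS0 : S \subset S0.
  by apply/fintype.subsetP => i; rewrite inE; apply: contraTT => /hS0 ->; rewrite ltxx.
move=> /(_ SS0) expS IHg.
have -> : \sum_i p i * h i = \sum_i p i * g i + a * \sum_(i in S) p i.
  rewrite mulr_sumr [X in _ + X]big_mkcond -big_split; apply: eq_bigr => i _ /=.
  by case: ifPn => iS; [rewrite gE//; ring|rewrite gN// hN//; ring].
(* Subtracting [a] on [S] affects only the terms with [i] in [S] and [j] outside, each by exactly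
   [a]. *)
have -> : \sum_i \sum_j q i j * Num.max (h i - h j) 0 =
   \sum_i \sum_j q i j * Num.max (g i - g j) 0
   + a * \sum_(i in S) \sum_(j in ~: S) q i j.
  rewrite mulr_sumr [X in _ + X]big_mkcond -big_split; apply: eq_bigr => i _ /=.
  case: ifPn => iS.
    rewrite mulr_sumr [X in _ + X]big_mkcond -big_split; apply: eq_bigr => j _ /=.
    rewrite inE; case: ifPn => jS.
      rewrite (gN j jS) (hN j jS) !subr0 !max_l //; first by rewrite gE//; ring.
    by rewrite addr0 !gE ?(negbNE jS)//; congr (_ * Num.max _ _); ring.
  rewrite addr0; apply: eq_bigr => j _; rewrite (gN i)// (hN i)// !sub0r.
  by rewrite !max_r ?oppr_le0.
rewrite mulrDr lerD//.
by rewrite mulrCA ler_wpM2l// ltW.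
Qed.

(** [coarea_le] is applied to [g ^+ 2]. The positive part of [h i - h j] is half of it plus half of
    its absolute value: the first half sums to zero because row and column sums agree, and AM-GM
    bounds the second by energy and norm. *)
Lemma cheeger_supported (c : R) (S0 : {set I}) (c_ge0 : 0 <= c)
    (expS0 : forall S : {set I}, S != finset.set0 -> S \subset S0 ->
       c * \sum_(i in S) p i <= \sum_(i in S) \sum_(j in ~: S) q i j)
    (g : I -> R) :
  (forall i, i \notin S0 -> g i = 0) ->
  c ^+ 2 / 2 * \sum_i p i * g i ^+ 2 <= dirichlet g.
Proof.
move=> gS0; have [->|c_neq0] := eqVneq c 0.
  by rewrite expr0n/= !mul0r dirichlet_ge0.
have c_gt0 : 0 < c by rewrite lt_neqAle eq_sym c_neq0.
pose h i := g i ^+ 2.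
have := @coarea_le c S0 expS0 h (fun i => sqr_ge0 (g i)).
have h0 i : i \notin S0 -> h i = 0 by move=> /gS0; rewrite /h => ->; rewrite expr0n.
move=> /(_ h0).
set N := \sum_i p i * h i; rewrite -/N => coarea.
(* AM-GM: |a b| <= a^2/c + c b^2/4 with a = g i - g j, b = g i + g j, and
   b^2 <= 2 (h i + h j) *)
have step : \sum_i \sum_j q i j * Num.max (h i - h j) 0 <=
   \sum_i \sum_j (q i j * (h i / 2 - h j / 2)
     + c^-1 * (2^-1 * (q i j * (g i - g j) ^+ 2))
     + c / 4 * (q i j * h i) + c / 4 * (q i j * h j)).
  apply: ler_sum => i _; apply: ler_sum => j _.
  rewrite [leRHS](_ : _ = q i j * (h i / 2 - h j / 2 + c^-1 * (2^-1 * (g i - g j) ^+ 2)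
     + c / 4 * h i + c / 4 * h j)); last by ring.
  rewrite ler_wpM2l// /h.
  set x := g i; set y := g j.
  (* The two branches of the maximum require opposite signs of [(x - y) * (x + y)], hence two
     completed squares; [sq3] is [c / 8] times the loss in
     [(x + y) ^+ 2 <= 2 * (x ^+ 2 + y ^+ 2)]. *)
  have sq1 : 0 <= c^-1 * (2^-1 * (x - y) ^+ 2) - 2^-1 * ((x - y) * (x + y)) + c / 8 * (x + y) ^+ 2.
    rewrite (_ : _ + _ = c^-1 / 2 * ((x - y) - c / 2 * (x + y)) ^+ 2); last by field; rewrite ?c_neq0.
    by rewrite mulr_ge0 ?sqr_ge0// divr_ge0 ?invr_ge0 ?ltW.
  have sq2 : 0 <= c^-1 * (2^-1 * (x - y) ^+ 2) + 2^-1 * ((x - y) * (x + y)) + c / 8 * (x + y) ^+ 2.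
    rewrite (_ : _ + _ = c^-1 / 2 * ((x - y) + c / 2 * (x + y)) ^+ 2); last by field; rewrite ?c_neq0.
    by rewrite mulr_ge0 ?sqr_ge0// divr_ge0 ?invr_ge0 ?ltW.
  have sq3 : 0 <= c / 8 * (x - y) ^+ 2 by rewrite mulr_ge0 ?sqr_ge0// divr_ge0 ?ltW.
  have e1 : c / 8 * (x + y) ^+ 2 = c / 4 * x ^+ 2 + c / 4 * y ^+ 2 - c / 8 * (x - y) ^+ 2 by field.
  have e2 : (x - y) * (x + y) = x ^+ 2 - y ^+ 2 by ring.
  rewrite e1 e2 in sq1 sq2.
  by rewrite ge_max; apply/andP; split; lra.
have sumE : \sum_i \sum_j (q i j * (h i / 2 - h j / 2)
     + c^-1 * (2^-1 * (q i j * (g i - g j) ^+ 2))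
     + c / 4 * (q i j * h i) + c / 4 * (q i j * h j)) =
   c^-1 * dirichlet g + c / 2 * N.
  have -> : c^-1 * dirichlet g + c / 2 * N =
     2^-1 * (\sum_i \sum_j q i j * h i) - 2^-1 * (\sum_i \sum_j q i j * h j)
     + c^-1 * dirichlet g + c / 4 * (\sum_i \sum_j q i j * h i)
     + c / 4 * (\sum_i \sum_j q i j * h j).
    by rewrite flow_sum_row flow_sum_col -/N; field.
  rewrite /dirichlet !mulr_sumr -sumrB -!big_split; apply: eq_bigr => i _ /=.
  rewrite !mulr_sumr -sumrB -!big_split; apply: eq_bigr => j _ /=; field.
  by rewrite c_neq0.
rewrite sumE in step; have {coarea step} := le_trans coarea step.
rewrite -(ler_pM2l c_gt0) mulrDr [c * (c^-1 * _)]mulrA mulfV// mul1r.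
rewrite (_ : c * (c / 2 * N) = c ^+ 2 / 2 * N); last by field.
rewrite (_ : c * (c * N) = c ^+ 2 / 2 * N + c ^+ 2 / 2 * N); last by field.
by rewrite lerD2r.
Qed.

(** The median is the least value of [f] with at most half of the mass strictly above it. The next
    lower value violates this, and the points strictly above that value are exactly those not below
    the median. *)
Lemma weighted_median (f : I -> R) (i0 : I) :
  exists c, \sum_(i | c < f i) p i <= 2^-1 * \sum_i p i /\
            \sum_(i | f i < c) p i <= 2^-1 * \sum_i p i.
Proof.
pose ok k := \sum_(i | f k < f i) p i <= 2^-1 * \sum_i p i.
have [kmax [_ kmaxP]] : exists k, true /\ forall i, f i <= f k.
  by case: (@arg_maxP _ _ _ i0 xpredT f isT) => k _ kP; exists k; split => // i; apply: kP.
have half_ge0 : 0 <= 2^-1 * \sum_i p i.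
  by rewrite mulr_ge0 ?invr_ge0 ?ler0n// sumr_ge0// => i _; exact: flow_weight_ge0.
have okmax : ok kmax.
  by rewrite /ok big_pred0// => i; apply/negbTE; rewrite -leNgt.
case: (arg_minP f okmax) => k okk kmin; exists (f k); split=> //.
have [/existsP[j0 ltj0]|/existsPn nolt] := boolP [exists j, f j < f k]; last first.
  by rewrite big_pred0// => i; apply/negbTE/nolt.
case: (@arg_maxP _ _ _ j0 (fun j => f j < f k) f ltj0) => j ltj jmax.
have Nok : ~~ ok j by apply/negP => /kmin; rewrite leNgt ltj.
move: Nok; rewrite /ok -ltNge => okj.
have {okj}: \sum_i p i = \sum_(i | f i < f k) p i + \sum_(i | f j < f i) p i ->
    \sum_(i | f i < f k) p i <= 2^-1 * \sum_i p i by move: okj; lra.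
apply.
rewrite (bigID (fun i => f i < f k)) /=; congr (_ + _).
apply: eq_bigl => i; apply/idP/idP => [|jlt].
  by rewrite -leNgt; apply: lt_le_trans.
by apply/negP => /jmax /(lt_le_trans jlt); rewrite ltxx.
Qed.

(** After a shift by a median, the positive and negative parts live on sets of at most half the
    mass, where [cheeger_supported] applies. *)
Lemma cheeger_inequality (c : R) (c_ge0 : 0 <= c)
    (expand : forall S : {set I}, S != finset.set0 ->
       \sum_(i in S) p i <= 2^-1 * \sum_i p i ->
       c * \sum_(i in S) p i <= \sum_(i in S) \sum_(j in ~: S) q i j)
    (f : I -> R) (f_mean0 : \sum_i p i * f i = 0) :
  c ^+ 2 / 2 * \sum_i p i * f i ^+ 2 <= dirichlet f.
Proof.
have [|[i0 _]] := set_0Vmem [set: I].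
  move=> I0; rewrite big1 ?mulr0 ?dirichlet_ge0// => i.
  by have := finset.in_setT i; rewrite I0 inE.
have [a [up dn]] := weighted_median f i0.
pose gp i := Num.max (f i - a) 0; pose gm i := Num.max (a - f i) 0.
have expP (P : pred I) : \sum_(i | P i) p i <= 2^-1 * \sum_i p i ->
    forall S : {set I}, S != finset.set0 -> S \subset [set i | P i] ->
      c * \sum_(i in S) p i <= \sum_(i in S) \sum_(j in ~: S) q i j.
  move=> leP S S0 SP; apply: expand => //; apply: le_trans leP.
  rewrite big_mkcond [leRHS]big_mkcond; apply: ler_sum => i _.
  case: ifPn => [/(fintype.subsetP SP)|_]; first by rewrite inE => ->.
  by case: ifP => // _; apply: flow_weight_ge0.
have hp := cheeger_supported c_ge0 (expP _ up) (g := gp).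
have hm := cheeger_supported c_ge0 (expP _ dn) (g := gm).
have {}hp : c ^+ 2 / 2 * \sum_i p i * gp i ^+ 2 <= dirichlet gp.
  by apply: hp => i; rewrite inE -leNgt => le; rewrite /gp max_r// subr_le0.
have {}hm : c ^+ 2 / 2 * \sum_i p i * gm i ^+ 2 <= dirichlet gm.
  by apply: hm => i; rewrite inE -leNgt => le; rewrite /gm max_r// subr_le0.
(* Across the level [a] this is [x ^+ 2 + y ^+ 2 <= (x + y) ^+ 2] for [x, y >= 0]; on one side of it
   the terms agree. *)
have energy : dirichlet gp + dirichlet gm <= dirichlet f.
  rewrite /dirichlet -mulrDr ler_pM2l ?invr_gt0 ?ltr0n// -big_split; apply: ler_sum => i _ /=.
  rewrite -big_split; apply: ler_sum => j _ /=; rewrite -mulrDr ler_wpM2l// /gp /gm.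
  by case: (ltrP (f i - a) 0) (ltrP (a - f i) 0) (ltrP (f j - a) 0) (ltrP (a - f j) 0)
     => [] ? [] ? [] ? [] ?; nra.
(* Since [f] has mean zero, recentring at [a] only adds [a ^+ 2] times the total mass. *)
have norm : \sum_i p i * f i ^+ 2 <= \sum_i p i * gp i ^+ 2 + \sum_i p i * gm i ^+ 2.
  have -> : \sum_i p i * f i ^+ 2 = \sum_i p i * f i ^+ 2 - 2 * a * \sum_i p i * f i.
    by rewrite f_mean0 mulr0 subr0.
  rewrite mulr_sumr -sumrB -big_split.
  apply: ler_sum => i _ /=; rewrite -mulrDr.
  rewrite (_ : _ - _ = p i * (f i ^+ 2 - 2 * a * f i)); last by ring.
  rewrite ler_wpM2l ?flow_weight_ge0// /gp /gm.
  by case: (ltrP (f i - a) 0) (ltrP (a - f i) 0) => [] ? [] ?; nra.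
apply: le_trans energy; apply: le_trans (lerD hp hm).
by rewrite -mulrDr ler_wpM2l// divr_ge0// sqr_ge0.
Qed.

Hypothesis p_gt0 : forall i, 0 < p i.

(** * The resolvent of a flow as a stochastic kernel *)

Section Resolvent.
Variable s : R.
Hypothesis s_ge0 : 0 <= s.

(** Minimum principle: where [x] is smallest, [\sum_j q k j * x j] is at least [p k * x k], so the
    quantity assumed nonnegative is at most [p k * x k] there. *)
Lemma resolvent_ge0 (x : I -> R) :
  (forall i, 0 <= (1 + s) * (p i * x i) - s * \sum_k q i k * x k) ->
  forall i, 0 <= x i.
Proof.
move=> hx i; case: (@arg_minP _ _ _ i xpredT x isT) => k _ kmin.
apply: le_trans (kmin i isT); rewrite -(pmulr_rge0 _ (p_gt0 k)).
apply: le_trans (hx k) _.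
have : p k * x k <= \sum_j q k j * x j.
  by rewrite -q_row mulr_suml; apply: ler_sum => j _; rewrite ler_wpM2l ?kmin.
by move=> /(ler_wpM2l s_ge0); rewrite mulrDl mul1r; lra.
Qed.

(** With [P i j = q i j / p i], the hypothesis on [K] is row [i] of [(1 + s (1 - P)) K = 1]
    multiplied by [p i]. *)
Variable K : I -> I -> R.
Hypothesis K_resolvent : forall i j,
  (1 + s) * (p i * K i j) - s * \sum_k q i k * K k j = p i * (i == j)%:R.

(** Puts [K x] in the form required by [resolvent_ge0], so that nonnegativity of [x] passes to
    [K x]. *)
Lemma resolvent_apply (x : I -> R) i :
  (1 + s) * (p i * \sum_j K i j * x j) - s * \sum_k q i k * (\sum_j K k j * x j)
  = p i * x i.
Proof.
transitivity (\sum_j (p i * (i == j)%:R) * x j); last first.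
  rewrite (bigD1 i)//= eqxx mulr1 big1 ?addr0// => j /negPf ji.
  by rewrite eq_sym ji mulr0 mul0r.
under [RHS]eq_bigr do rewrite -K_resolvent mulrBl.
rewrite sumrB mulr_sumr mulr_sumr; congr (_ - _).
  by apply: eq_bigr => j _; ring.
under [RHS]eq_bigr do rewrite -mulrA mulr_suml.
rewrite -mulr_sumr exchange_big /=; congr (_ * _).
by apply: eq_bigr => k _; rewrite mulr_sumr; apply: eq_bigr => j _; ring.
Qed.

(** [K] applied to the constant one and the constant itself solve the same equation; the minimum
    principle for their difference, with either sign, forces equality. *)
Lemma resolvent_row i : \sum_j K i j = 1.
Proof.
have eq1 k : (1 + s) * (p k * \sum_j K k j) - s * \sum_l q k l * (\sum_j K l j) = p k.
  rewrite -[RHS]mulr1 -(resolvent_apply (fun=> 1) k).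
  congr (_ * (_ * _) - _ * _); first by apply: eq_bigr => j _; rewrite mulr1.
  by apply: eq_bigr => j _; congr (_ * _); apply: eq_bigr => l _; rewrite mulr1.
have sB k (c : R) : \sum_l q k l * (c * (\sum_j K l j - 1))
    = c * (\sum_l q k l * (\sum_j K l j) - p k).
  by rewrite -q_row -sumrB mulr_sumr; apply: eq_bigr => l _; ring.
apply/le_anti/andP; split.
  rewrite -subr_ge0 -opprB -mulN1r; move: i.
  by apply: resolvent_ge0 => i; rewrite sB; have := eq1 i; lra.
rewrite -subr_ge0 -[X in 0 <= X]mul1r; move: i.
by apply: resolvent_ge0 => i; rewrite sB; have := eq1 i; lra.
Qed.

Lemma resolvent_col j : \sum_i p i * K i j = p j.
Proof.
have : \sum_i ((1 + s) * (p i * K i j) - s * \sum_k q i k * K k j)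
    = \sum_i p i * (i == j)%:R by apply: eq_bigr => i _; apply: K_resolvent.
rewrite sumrB -!mulr_sumr (flow_sum_col (fun k => K k j)).
have -> : \sum_i p i * (i == j)%:R = p j.
  by rewrite (bigD1 j)//= eqxx big1 ?mulr1 ?addr0// => i /negPf ->; rewrite mulr0.
lra.
Qed.

(** With [y = K x], pairing the resolvent equation with [y] gives
    [\sum_i p i * y i ^+ 2 + s * dirichlet y]. *)
Lemma resolvent_accretive (x : I -> R) :
  0 <= \sum_i \sum_j p i * K i j * (x i * x j).
Proof.
pose y i := \sum_j K i j * x j.
have -> : \sum_i \sum_j p i * K i j * (x i * x j) = \sum_i (p i * x i) * y i.
  by apply: eq_bigr => i _; rewrite mulr_sumr; apply: eq_bigr => j _; ring.
have -> : \sum_i (p i * x i) * y i = \sum_i p i * y i ^+ 2 + s * dirichlet y.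
  rewrite dirichletE mulrBr !mulr_sumr addrA -big_split -sumrB /=.
  apply: eq_bigr => i _; rewrite -resolvent_apply -/(y i) mulrBl.
  congr (_ - _); first by ring.
  rewrite mulr_sumr mulr_suml mulr_sumr; apply: eq_bigr => k _.
  by rewrite -/(y k); ring.
apply: addr_ge0; last exact: mulr_ge0 (dirichlet_ge0 _).
apply: sumr_ge0 => i _.
by rewrite mulr_ge0 ?sqr_ge0 ?flow_weight_ge0.
Qed.

(** Accretivity is tested on the difference of the indicators of [i] and [j], each divided by its
    weight, then multiplied by [p i * p j]. *)
Lemma resolvent_offdiag i j :
  p i * K i j + p j * K j i <= p j * K i i + p i * K j j.
Proof.
have [->|ij] := eqVneq i j; first by [].
pose x k := (k == i)%:R / p i - (k == j)%:R / p j.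
have xi : x i = (p i)^-1 by rewrite /x eqxx (negPf ij) mul0r subr0 mul1r.
have xj : x j = - (p j)^-1.
  by rewrite /x eqxx eq_sym (negPf ij) mul0r sub0r mul1r.
have x0 k : k != i -> k != j -> x k = 0.
  by move=> /negPf ki /negPf kj; rewrite /x ki kj !mul0r subrr.
have sumx (F : I -> R) : \sum_k F k * x k = F i / p i - F j / p j.
  rewrite (bigD1 i)//= (bigD1 j) 1?eq_sym//= xi xj big1 => [|k /andP[ki kj]].
    by rewrite addr0 mulrN.
  by rewrite x0 ?mulr0.
have := resolvent_accretive x.
have -> : \sum_k \sum_l p k * K k l * (x k * x l)
    = \sum_k (p k * (K k i / p i - K k j / p j)) * x k.
  apply: eq_bigr => k _; rewrite -sumx mulr_sumr mulr_suml.
  by apply: eq_bigr => l _; ring.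
have pi := p_gt0 i; have pj := p_gt0 j.
rewrite sumx -(pmulr_rge0 _ (mulr_gt0 pi pj)).
rewrite [leRHS](_ : _ = p j * K i i + p i * K j j - (p i * K i j + p j * K j i)); last first.
  by field; rewrite !gt_eqF.
by rewrite subr_ge0.
Qed.

(** Summing [resolvent_offdiag] over all pairs in [S] counts each side twice. *)
Lemma resolvent_diag_block (S : {set I}) :
  \sum_(i in S) \sum_(j in S) p i * K i j <=
  (\sum_(i in S) p i) * \sum_(i in S) K i i.
Proof.
have : \sum_(i in S) \sum_(j in S) (p i * K i j + p j * K j i) <=
    \sum_(i in S) \sum_(j in S) (p j * K i i + p i * K j j).
  by apply: ler_sum => i _; apply: ler_sum => j _; apply: resolvent_offdiag.
under eq_bigr do rewrite big_split /=; under [leRHS]eq_bigr do rewrite big_split /=.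
rewrite !big_split /= [X in _ + X <= _]exchange_big [X in _ <= X + _]exchange_big /=.
rewrite [X in _ <= X + _]exchange_big /=.
under [X in _ <= X + _]eq_bigr do rewrite -mulr_suml.
under [X in _ <= _ + X]eq_bigr do rewrite -mulr_sumr.
rewrite -mulr_sumr -mulr_suml; lra.
Qed.

(** Let [y] be [K] applied to the indicator of the complement, so [0 <= y <= 1]. On [S] the
    resolvent equation reads [p y = s (q y - p y)]; after summation over [S] the flow within [S] is
    absorbed by [p y], leaving at most the [q]-flow out of [S]. *)
Lemma resolvent_cut (S : {set I}) :
  \sum_(i in S) \sum_(j in ~: S) p i * K i j <=
  s * \sum_(i in S) \sum_(j in ~: S) q i j.
Proof.
pose y k := \sum_j K k j * (j \in ~: S)%:R.
have y_ge0 k : 0 <= y k.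
  by move: k; apply: resolvent_ge0 => i; rewrite resolvent_apply mulr_ge0// ltW.
have y_le1 k : y k <= 1.
  have e : 1 - y k = \sum_j K k j * (j \in S)%:R.
    rewrite -[X in X - _ = _](resolvent_row k) -sumrB; apply: eq_bigr => j _.
    by rewrite inE; case: (j \in S); rewrite /= ?(mulr0, mulr1, subr0, subrr).
  rewrite -subr_ge0 e; move: {e} k.
  by apply: resolvent_ge0 => i; rewrite resolvent_apply mulr_ge0// ltW.
have -> : \sum_(i in S) \sum_(j in ~: S) p i * K i j = \sum_(i in S) p i * y i.
  apply: eq_bigr => i _; rewrite /y mulr_sumr big_mkcond; apply: eq_bigr => j _ /=.
  by case: ifP => _; rewrite ?(mulr0,mulr1).
have -> : \sum_(i in S) p i * y i
    = s * (\sum_(i in S) (\sum_k q i k * y k - p i * y i)).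
  rewrite mulr_sumr; apply: eq_bigr => i iS.
  have := resolvent_apply (fun j => (j \in ~: S)%:R) i.
  by rewrite inE iS /= mulr0 -/(y i) /y; lra.
rewrite ler_wpM2l// sumrB.
have -> : \sum_(i in S) \sum_k q i k * y k =
    \sum_(k in S) (\sum_(i in S) q i k) * y k
    + \sum_(i in S) \sum_(k in ~: S) q i k * y k.
  under [X in _ = X + _]eq_bigr do rewrite mulr_suml.
  rewrite [X in _ = X + _]exchange_big -big_split; apply: eq_bigr => i _ /=.
  by rewrite (bigID (mem S)) /=; congr (_ + _); apply: eq_bigl => k; rewrite inE.
have le1 : \sum_(k in S) (\sum_(i in S) q i k) * y k <= \sum_(i in S) p i * y i.
  apply: ler_sum => k _; rewrite ler_wpM2r// -q_col [leRHS](bigID (mem S)) /=.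
  by rewrite lerDl sumr_ge0.
have le2 : \sum_(i in S) \sum_(k in ~: S) q i k * y k <=
    \sum_(i in S) \sum_(j in ~: S) q i j.
  by apply: ler_sum => i _; apply: ler_sum => k _; rewrite ler_piMr.
lra.
Qed.

(** [K] keeps at most the fraction [t] of the mass of [S] inside [S], and at most [t'] of the mass
    of the complement inside the complement; the remainder is the same [k] in both cases. *)
Lemma resolvent_trace_cut (S : {set I}) :
  S != finset.set0 -> \sum_(i in S) p i <= 2^-1 * \sum_i p i ->
  (2 - \sum_i K i i) * \sum_(i in S) p i
   <= 2 * s * \sum_(i in S) \sum_(j in ~: S) q i j.
Proof.
move=> /set0Pn[i0 i0S] leS.
set a := \sum_(i in S) p i in leS *.
set t := \sum_(i in S) K i i; set t' := \sum_(i in ~: S) K i i.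
pose a' := \sum_(i in ~: S) p i.
have split_sum (F : I -> R) : \sum_i F i = \sum_(i in S) F i + \sum_(i in ~: S) F i.
  by rewrite (bigID (mem S)) /=; congr (_ + _); apply: eq_bigl => k; rewrite inE.
rewrite split_sum -/t -/t'; move: leS; rewrite split_sum -/a -/a' => leS.
have a_gt0 : 0 < a.
  by rewrite /a (bigD1 i0)//= ltr_pwDl// sumr_ge0// => i _; rewrite ltW.
have cut := resolvent_cut S.
set k := \sum_(i in S) \sum_(j in ~: S) p i * K i j in cut.
have rowS : a = \sum_(i in S) \sum_(j in S) p i * K i j + k.
  rewrite /a /k -big_split; apply: eq_bigr => i _ /=.
  by rewrite -[LHS]mulr1 -(resolvent_row i) mulr_sumr split_sum.
(* Stationarity lets the mass of the complement be counted by columns, so that the flow [k] out of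
   [S] appears again. *)
have colS : a' = k + \sum_(i in ~: S) \sum_(j in ~: S) p i * K i j.
  rewrite /a' /k [X in _ = X + _]exchange_big [X in _ = _ + X]exchange_big -big_split.
  by apply: eq_bigr => j _ /=; rewrite -resolvent_col split_sum.
have b1 := resolvent_diag_block S; have b2 := resolvent_diag_block (~: S).
rewrite -/a -/t in b1; rewrite -/a' -/t' in b2.
have k_ge0 : 0 <= k.
  rewrite /k; apply: sumr_ge0 => i _; apply: sumr_ge0 => j _.
  rewrite mulr_ge0 ?flow_weight_ge0//.
  have -> : K i j = \sum_l K i l * (l == j)%:R.
    by rewrite (bigD1 j)//= eqxx mulr1 big1 ?addr0// => l /negPf ->; rewrite mulr0.
  by move: (i); apply: resolvent_ge0 => i'; rewrite resolvent_apply mulr_ge0// ltW.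
have {}b1 : (1 - t) * a <= k by lra.
have {}b2 : (1 - t') * a' <= k by lra.
(* As [a <= a'], a nonnegative factor [1 - t'] keeps the bound; otherwise the left side is
   negative. *)
have {}b2 : (1 - t') * a <= k.
  by case: (leP 0 (1 - t')) => ?; [nra|rewrite (le_trans _ k_ge0)// nmulr_rle0// ltW].
lra.
Qed.

End Resolvent.
End Flow.

(** * Derivative of the characteristic polynomial *)

Section CharPoly.
Variable R : comNzRingType.

Lemma deriv_prod_uniq (I : eqType) (r : seq I) (F : I -> {poly R}) : uniq r ->
  (\prod_(i <- r) F i)^`() =
  \sum_(i <- r) \prod_(j <- r) (if j == i then (F j)^`() else F j).
Proof.
elim: r => [|x r IH] /=; first by rewrite !big_nil derivC.
move=> /andP[xr /IH {}IH]; rewrite !big_cons derivM IH eqxx; congr (_ * _ + _).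
  by rewrite [LHS]big_seq [RHS]big_seq; apply: eq_bigr => j jr; case: eqVneq jr xr => // -> ->.
rewrite mulr_sumr [LHS]big_seq [RHS]big_seq; apply: eq_bigr => i ir; rewrite big_cons.
by case: eqVneq ir xr => // -> ->.
Qed.

(** Jacobi's formula, one row at a time: [D i] is [M] with row [i] differentiated, and its
    determinant is expanded along that row. *)
Lemma deriv_det n (M : 'M[{poly R}]_n) :
  (\det M)^`() = \sum_i \sum_j (M i j)^`() * cofactor M i j.
Proof.
pose D i := \matrix_(k, j) (if k == i then (M k j)^`() else M k j).
transitivity (\sum_i \det (D i)).
  rewrite /determinant exchange_big [LHS]raddf_sum; apply: eq_bigr => s _ /=.
  rewrite derivM -[-1]/(- 1%:P) -polyCN -rmorphXn derivC mul0r add0r.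
  rewrite deriv_prod_uniq ?index_enum_uniq// mulr_sumr; apply: eq_bigr => i _.
  by congr (_ * _); apply: eq_bigr => j _; rewrite mxE.
apply: eq_bigr => i _; rewrite (expand_det_row _ i); apply: eq_bigr => j _.
rewrite mxE eqxx; congr (_ * (_ * \det _)); apply/matrixP => k l.
by rewrite !mxE eq_sym (negPf (neq_lift _ _)).
Qed.

Lemma deriv_char_poly_adj n (A : 'M[R]_n) :
  (char_poly A)^`() = \tr (\adj (char_poly_mx A)).
Proof.
rewrite /char_poly deriv_det; apply: eq_bigr => i _.
rewrite (bigD1 i)//= big1 => [|j /negPf ji]; rewrite !mxE ?eqxx.
  by rewrite mulr1n derivB derivX derivC subr0 mul1r addr0.
by rewrite eq_sym ji mulr0n sub0r derivN derivC oppr0 mul0r.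
Qed.

(** The diagonal cofactors of [X - A] are characteristic polynomials of principal submatrices. This
    serves to prove that the Perron root is simple. *)
Lemma deriv_char_poly_minors n (A : 'M[R]_n) :
  (char_poly A)^`() = \sum_i char_poly (row' i (col' i A)).
Proof.
rewrite deriv_char_poly_adj; apply: eq_bigr => i _.
rewrite mxE /cofactor -signr_odd oddD addbb mul1r; congr (\det _).
by apply/matrixP => k l; rewrite !mxE (inj_eq lift_inj).
Qed.

Lemma horner_char_poly_mx n (A : 'M[R]_n) b :
  map_mx (horner_eval b) (char_poly_mx A) = b%:M - A.
Proof.
apply/matrixP => i j; rewrite !mxE /horner_eval.
by case: eqP; rewrite !hornerE.
Qed.

Lemma horner_char_poly n (A : 'M[R]_n) b : (char_poly A).[b] = \det (b%:M - A).
Proof. by rewrite -horner_char_poly_mx det_map_mx. Qed.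

(** For [B = b - A], the relation [B M = 1] gives [\adj B = \det B *: M]; this is the logarithmic
    derivative of the characteristic polynomial, stated without division. *)
Lemma trace_resolvent n (A M : 'M[R]_n) b : (b%:M - A) *m M = 1%:M ->
  (char_poly A)^`().[b] = (char_poly A).[b] * \tr M.
Proof.
move=> BM; rewrite horner_char_poly.
have -> : (char_poly A)^`().[b] = \tr (\adj (b%:M - A)).
  rewrite deriv_char_poly_adj -horner_char_poly_mx -map_mx_adj -[LHS]/(horner_eval b _).
  by rewrite rmorph_sum; apply: eq_bigr => i _; rewrite !mxE.
by rewrite -[in LHS](mulmx1 (\adj _)) -BM mulmxA mul_adj_mx mul_scalar_mx linearZ.
Qed.

End CharPoly.

Lemma log_deriv_prod_XsubC (F : fieldType) (rs : seq F) b : b \notin rs ->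
  (\prod_(z <- rs) ('X - z%:P))^`().[b] =
  (\prod_(z <- rs) ('X - z%:P)).[b] * \sum_(z <- rs) (b - z)^-1.
Proof.
elim: rs => [|z rs IH]; first by rewrite !big_nil derivC horner0 mulr0.
rewrite inE negb_or => /andP[bz /IH {}IH].
rewrite !big_cons derivM derivXsubC !hornerE IH.
by field; rewrite subr_eq0.
Qed.

(** * The Perron-Frobenius theorem *)

Section PerronFrobenius.
Variables (R : realType) (n : nat).
Implicit Types (H : 'M[R]_n) (v x : 'cV[R]_n).

Lemma irreducible_trmx H : irreducible_mx H -> irreducible_mx H^T.
Proof.
move=> [H0 Hirr]; split=> [i j|s t]; first by rewrite mxE.
have trX k : H^T ^+ k = (H ^+ k)^T.
  elim: k => [|k IH]; first by rewrite !expr0 trmx1.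
  by rewrite exprS exprSr IH -[LHS]/(_ *m _) -trmx_mul.
by have [k [k0 kP]] := Hirr t s; exists k; rewrite trX mxE.
Qed.

Lemma nonneg_expr H k : nonneg_mx H -> nonneg_mx (H ^+ k).
Proof.
move=> H0; elim: k => [|k IH] i j; first by rewrite expr0 mxE ler0n.
by rewrite exprS mxE sumr_ge0// => l _; rewrite mulr_ge0.
Qed.

Lemma expr_eigen H x t k : H *m x = t *: x -> H ^+ k *m x = t ^+ k *: x.
Proof.
move=> Hx; elim: k => [|k IH]; first by rewrite !expr0 mul1mx scale1r.
by rewrite exprSr -[_ * H]/(_ *m H) -mulmxA Hx -scalemxAr IH scalerA -exprS.
Qed.

(** Some [x j 0] is positive and some [H ^+ k] has a positive [(i, j)] entry, so
    [t ^+ k * x i 0 > 0]. *)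
Lemma irreducible_eigen_gt0 H x t : irreducible_mx H ->
  (forall i, 0 <= x i 0) -> x != 0 -> H *m x = t *: x ->
  forall i, 0 < x i 0.
Proof.
move=> [H0 Hirr] x0 xn0 Hx i.
have [j xj] : exists j, 0 < x j 0.
  apply/existsP; apply: contraNT xn0; rewrite negb_exists => /forallP xle.
  apply/eqP/colP => j; rewrite mxE; apply/le_anti.
  by rewrite x0 leNgt xle.
have [k [_ kP]] := Hirr i j.
have : 0 < (H ^+ k *m x) i 0.
  rewrite mxE (bigD1 j)//= ltr_pwDl ?mulr_gt0// sumr_ge0// => l _.
  by rewrite mulr_ge0// nonneg_expr.
rewrite (expr_eigen _ Hx) mxE => txi; rewrite lt0r x0 andbT.
by apply: contraTneq txi => ->; rewrite mulr0 ltxx.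
Qed.

Lemma irreducible_eigenval_gt0 H x t (i : 'I_n) : irreducible_mx H ->
  (forall i, 0 < x i 0) -> H *m x = t *: x -> 0 < t.
Proof.
move=> [H0 Hirr] x0 Hx.
have [k [k0 kP]] := Hirr i i.
have : 0 < (H *m x) i 0.
  have : 0 <= (H *m x) i 0.
    by rewrite mxE sumr_ge0// => l _; rewrite mulr_ge0// ltW.
  rewrite le0r => /orP[/eqP e|//].
  have t0 : t = 0.
    by move: e; rewrite Hx mxE => /eqP; rewrite mulf_eq0 (gt_eqF (x0 i)) orbF => /eqP.
  have : 0 < (H ^+ k *m x) i 0.
    rewrite mxE (bigD1 i)//= ltr_pwDl ?mulr_gt0// sumr_ge0// => l _.
    by rewrite mulr_ge0 ?(ltW (x0 _))// nonneg_expr.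
  (* Here [0 < k] matters, since [0 ^+ 0 = 1]. *)
  by rewrite (expr_eigen _ Hx) t0 expr0n -[k == 0%N]negbK -lt0n k0 /= mxE mul0r ltxx.
by rewrite Hx mxE pmulr_lgt0.
Qed.

(** [B] sums one power of [H] for each pair of indices, chosen to be positive at that pair. It makes
    every nonzero nonnegative vector positive while commuting with [H]. *)
Lemma irreducible_positive_comm H : irreducible_mx H ->
  exists B : 'M[R]_n, H *m B = B *m H /\ forall i j, 0 < B i j.
Proof.
move=> [H0 Hirr].
pose k s t := sval (cid (Hirr s t)).
have kP s t : 0 < (H ^+ k s t) s t by rewrite /k; case: cid => ? [].
exists (\sum_s \sum_t H ^+ k s t); split.
  rewrite mulmx_sumr mulmx_suml; apply: eq_bigr => s _.
  rewrite mulmx_sumr mulmx_suml; apply: eq_bigr => t _.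
  by rewrite -[LHS]/(H * _) -[RHS]/(_ * H) -exprS -exprSr.
move=> i j; rewrite summxE (bigD1 i)//= summxE (bigD1 j)//= -addrA.
rewrite ltr_pwDl// addr_ge0 ?sumr_ge0// => l _; first exact: nonneg_expr.
by rewrite summxE sumr_ge0// => m _; apply: nonneg_expr.
Qed.

Lemma row_sum_continuous (m : nat) (F : 'I_n -> 'rV[R]_m -> R) :
  (forall j, continuous (F j)) -> continuous (fun w => \sum_j F j w).
Proof.
by move=> Fc; apply: continuous_big => [|j _]; [exact: add_continuous|exact: Fc].
Qed.

(* The Collatz-Wielandt number: the largest [t] for which some probability
   vector [x] satisfies [t x <= H x]. A point [w] of R^(1+n) encodes [(t, x)]. *)
Lemma collatz_wielandt_max H (i0 : 'I_n) : nonneg_mx H ->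
  exists (t : R) x,
  [/\ 0 <= t, forall i, 0 <= x i 0, \sum_i x i 0 = 1,
      forall i, t * x i 0 <= (H *m x) i 0 &
      forall t' x', 0 <= t' -> (forall i, 0 <= x' i 0) -> \sum_i x' i 0 = 1 ->
        (forall i, t' * x' i 0 <= (H *m x') i 0) -> t' <= t].
Proof.
move=> H0.
(* [T] bounds both the entries of [x], at most [1], and [t], at most the sum of the entries of [H],
   so one cube holds all coordinates. *)
pose T := 1 + \sum_i \sum_j H i j.
have T0 : 0 <= \sum_i \sum_j H i j by rewrite !sumr_ge0// => i _; rewrite sumr_ge0.
pose X (w : 'rV[R]_n.+1) : 'cV[R]_n := \col_i w ord0 (lift ord0 i).
pose cube : set 'rV[R]_n.+1 :=
  [set w | forall i : 'I_n.+1, `[0, T] (w ord0 i)]%classic.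
pose simplex : set 'rV[R]_n.+1 := [set w | \sum_i w ord0 (lift ord0 i) = 1]%classic.
pose gapi i (w : 'rV[R]_n.+1) : R :=
  \sum_j H i j * w ord0 (lift ord0 j) - w ord0 ord0 * w ord0 (lift ord0 i).
pose K := (cube `&` (simplex `&` \bigcap_(i in setT) [set w | 0 <= gapi i w]))%classic.
have coordc k : continuous (fun w : 'rV[R]_n.+1 => w ord0 k) by exact: coord_continuous.
have compK : compact K.
  apply: compact_closedI; first by apply: (@rV_compact R n.+1 (fun=> `[0, T]%classic)) => i; exact: segment_compact.
  apply: closedI.
    apply: (@preimage_closed _ _ (fun w : 'rV[R]_n.+1 => \sum_i w ord0 (lift ord0 i)) [set x | x = 1]%classic).
      by move=> w _; apply: row_sum_continuous.
    exact: closed_eq.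
  apply: closed_bigI => i _.
  apply: (@preimage_closed _ _ (gapi i) [set x | 0 <= x]%classic); last exact: closed_ge.
  move=> w _; rewrite /gapi; apply: (@continuousB _ _ _
      (fun w : 'rV[R]_n.+1 => \sum_j H i j * w ord0 (lift ord0 j))
      (fun w => w ord0 ord0 * w ord0 (lift ord0 i))).
    apply: row_sum_continuous => j w'; apply: continuousM; first exact: cst_continuous.
    exact: coordc.
  by apply: continuousM; exact: coordc.
have inK t x : 0 <= t -> (forall i, 0 <= x i 0) -> \sum_i x i 0 = 1 ->
    (forall i, t * x i 0 <= (H *m x) i 0) ->
    K (\row_k (if unlift ord0 k is Some i then x i 0 else t)).
  move=> t0 x0 x1 tx.
  have x_le1 i : x i 0 <= 1.
    by rewrite -x1 (bigD1 i)//= lerDl sumr_ge0.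
  have tT : t <= \sum_i \sum_j H i j.
    rewrite -[t]mulr1 -x1 mulr_sumr; apply: ler_sum => i _.
    by apply: le_trans (tx i) _; rewrite mxE; apply: ler_sum => j _; rewrite ler_piMr.
  split; last split.
  - move=> k /=; rewrite mxE in_itv /= /T; case: unliftP => [j _|_].
      by rewrite x0 (le_trans (x_le1 j))// lerDl.
    by rewrite t0 (le_trans tT)// lerDr.
  - by rewrite /simplex /= -x1; apply: eq_bigr => i _; rewrite mxE liftK.
  - move=> i _; rewrite /gapi /= mxE unlift_none mxE liftK subr_ge0.
    apply: le_trans (tx i) _; rewrite mxE le_eqVlt; apply/orP/or_introl/eqP/eq_bigr => j _.
    by rewrite mxE liftK.
have K_ne : (K !=set0)%classic.
  eexists; apply: (inK 0 (delta_mx i0 0)) => //.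
  - by move=> i; rewrite mxE ler0n.
  - rewrite (bigD1 i0)//= mxE !eqxx big1 ?addr0// => i /negPf ii0.
    by rewrite mxE ii0.
  - move=> i; rewrite mul0r mxE sumr_ge0// => j _.
    by rewrite mulr_ge0// mxE ler0n.
have [w wK wmax] := @EVT_max_rV R n.+1 (fun w => w ord0 ord0) K K_ne compK
  (continuous_subspaceT (coordc ord0)).
move: wK; rewrite inE => -[wcube [wsimp wgap]].
exists (w ord0 ord0), (X w); split.
- by have := wcube ord0; rewrite /= in_itv /= => /andP[].
- by move=> i; rewrite mxE; have := wcube (lift ord0 i); rewrite /= in_itv /= => /andP[].
- by rewrite -[RHS]wsimp; apply: eq_bigr => i _; rewrite mxE.
- move=> i; have := wgap i I; rewrite /gapi /= subr_ge0 !mxE => /le_trans; apply.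
  by rewrite le_eqVlt; apply/orP/or_introl/eqP/eq_bigr => j _; rewrite mxE.
- move=> t' x' t'0 x'0 x'1 tx'; have := inK _ _ t'0 x'0 x'1 tx'.
  by rewrite -inE => /wmax; rewrite mxE unlift_none.
Qed.

(** At a Collatz-Wielandt maximiser [d = H x - t x] is nonnegative. Were it nonzero, [y = B x] would
    satisfy [H y - t y = B d > 0] in every coordinate, and [t] could be increased. *)
Lemma perron_right H : (0 < n)%N -> irreducible_mx H ->
  exists (t : R) x, (forall i, 0 < x i 0) /\ H *m x = t *: x.
Proof.
move=> n0 Hirr; have [H0 _] := Hirr; pose i0 := Ordinal n0.
have [t [x [t0 x0 x1 tx tmax]]] := collatz_wielandt_max i0 H0.
have xn0 : x != 0.
  apply: contraTneq isT => xe; move: x1; rewrite xe big1 => [|i _]; last by rewrite mxE.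
  by move/esym/eqP; rewrite oner_eq0.
suff Hx : H *m x = t *: x by exists t, x; split=> //; exact: irreducible_eigen_gt0 Hx.
apply/eqP; rewrite -subr_eq0; apply/negPn/negP => dn0.
have [B [HB B0]] := irreducible_positive_comm Hirr.
have Bpos (y : 'cV[R]_n) : (forall i, 0 <= y i 0) -> y != 0 -> forall i, 0 < (B *m y) i 0.
  move=> y0 yn0 i.
  have [j yj] : exists j, 0 < y j 0.
    apply/existsP; apply: contraNT yn0; rewrite negb_exists => /forallP yle.
    by apply/eqP/colP => j; rewrite mxE; apply/le_anti; rewrite y0 leNgt yle.
  rewrite mxE (bigD1 j)//= ltr_pwDl ?mulr_gt0// sumr_ge0// => l _.
  by rewrite mulr_ge0// ltW.
set d := H *m x - t *: x in dn0.
have d0 i : 0 <= d i 0 by rewrite !mxE subr_ge0 (le_trans (tx i))// mxE.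
pose y := B *m x; have ygt := Bpos x x0 xn0; have dgt := Bpos d d0 dn0.
have BdE : B *m d = H *m y - t *: y by rewrite mulmxBr mulmxA -HB -mulmxA scalemxAr.
case: (@arg_minP _ _ _ i0 xpredT (fun i => (B *m d) i 0 / y i 0) isT) => k _ kmin.
pose e := (B *m d) k 0 / y k 0.
have e0 : 0 < e by rewrite divr_gt0.
pose c := \sum_i y i 0.
have c0 : 0 < c.
  by rewrite /c (bigD1 i0)//= ltr_pwDl// sumr_ge0// => i _; rewrite ltW.
suff : t + e <= t by rewrite gerDl leNgt e0.
apply: (tmax _ (c^-1 *: y)).
- by rewrite addr_ge0// ltW.
- by move=> i; rewrite mxE mulr_ge0 ?invr_ge0 ?ltW.
- under eq_bigr do rewrite mxE.
  by rewrite -mulr_sumr mulVf// gt_eqF.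
- have scaleE a (z : 'cV[R]_n) i : (a *: z) i 0 = a * z i 0 by rewrite mxE.
  move=> i; rewrite -scalemxAr !scaleE mulrCA ler_pM2l ?invr_gt0//.
  have := kmin i isT; rewrite /= -/e ler_pdivlMr; last exact: ygt.
  have -> : (B *m d) i 0 = (H *m y) i 0 - t * y i 0
    by rewrite BdE -[t * y i 0]scaleE [LHS]mxE [X in _ + X]mxE.
  by rewrite mulrDl; lra.
Qed.

(** The right and left Perron roots agree: evaluating [u^T H v] from both sides gives
    [r' u^T v = r u^T v], with [u^T v > 0]. *)
Lemma perron_pair H : (0 < n)%N -> irreducible_mx H ->
  exists (r : R) (u v : 'cV[R]_n),
  [/\ 0 < r, forall i, 0 < v i 0, H *m v = r *: v,
      forall i, 0 < u i 0 & H^T *m u = r *: u].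
Proof.
move=> n0 Hirr; have [r [v [v0 Hv]]] := perron_right n0 Hirr.
have [r' [u [u0 Hu]]] := perron_right n0 (irreducible_trmx Hirr).
exists r, u, v; split=> //; first exact: irreducible_eigenval_gt0 (Ordinal n0) _ v0 Hv.
suff <- : r' = r by [].
have uv0 : 0 < (u^T *m v) 0 0.
  rewrite mxE (bigD1 (Ordinal n0))//= ltr_pwDl ?mxE ?mulr_gt0// sumr_ge0// => i _.
  by rewrite mxE mulr_ge0// ltW.
have : r' *: (u^T *m v) = r *: (u^T *m v).
  by rewrite [RHS]scalemxAr -Hv mulmxA scalemxAl -[r' *: u^T]linearZ /= -Hu trmx_mul trmxK.
move=> /matrixP /(_ 0 0); rewrite mxE [RHS]mxE => /eqP.
by rewrite (inj_eq (mulIf (negbT (gt_eqF uv0)))) => /eqP.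
Qed.

(* A principal submatrix has no real eigenvalue [t >= r]: padding the absolute
   value of an eigenvector by a zero would give a nonnegative eigenvector of the
   whole matrix that is not positive. *)
Lemma minor_char_poly_gt0 H r v (i : 'I_n) : irreducible_mx H ->
  (forall i, 0 < v i 0) -> H *m v = r *: v ->
  0 < (char_poly (row' i (col' i H))).[r].
Proof.
move=> Hirr v0 Hv; have [H0 _] := Hirr.
set A := row' i (col' i H).
have noroot t : r <= t -> ~~ root (char_poly A) t.
  move=> rt; rewrite -eigenvalue_root_char; apply/eigenvalueP => -[w wA wn0].
  pose x : 'cV[R]_n := \col_k (if unlift i k is Some l then `|w 0 l| else 0).
  have x0 k : 0 <= x k 0 by rewrite mxE; case: unliftP.
  have xi : x i 0 = 0 by rewrite mxE unlift_none.
  have xl l : x (lift i l) 0 = `|w 0 l| by rewrite mxE liftK.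
  have ge k : t * x k 0 <= (H^T *m x) k 0.
    case: (unliftP i k) => [l ->|->]; last first.
      by rewrite xi mulr0 mxE sumr_ge0// => m _; rewrite mulr_ge0// mxE.
    rewrite xl mxE (bigD1_ord i)//= xi mulr0 add0r.
    have -> : t * `|w 0 l| = `|t| * `|w 0 l|.
      by rewrite [`|t|]ger0_norm// (le_trans _ rt)// ltW// (irreducible_eigenval_gt0 i Hirr v0 Hv).
    rewrite -normrM; have -> : t * w 0 l = \sum_m w 0 m * H (lift i m) (lift i l).
      by move/rowP: wA => /(_ l); rewrite !mxE => <-; apply: eq_bigr => m _; rewrite !mxE.
    apply: le_trans (ler_norm_sum _ _ _) _; apply: ler_sum => m _.
    by rewrite xl !mxE normrM (ger0_norm (H0 _ _)) mulrC.
  (* Pairing with the Perron vector [v] gives zero although every term is nonnegative, as [r <= t];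
     hence [x] is an exact eigenvector. *)
  have pair : \sum_k ((H^T *m x) k 0 - r * x k 0) * v k 0 = 0.
    under eq_bigr do rewrite mulrBl.
    rewrite sumrB; apply/eqP; rewrite subr_eq0; apply/eqP.
    have := congr1 (fun M : 'M_1 => M 0 0) (mulmxA x^T H v).
    rewrite Hv -scalemxAr mxE mulrC [RHS]mxE => e.
    transitivity ((x^T *m v) 0 0 * r).
      rewrite e; apply: eq_bigr => k _; congr (_ * _).
      by rewrite -[in RHS](trmxK H) -trmx_mul [RHS]mxE.
    by rewrite mxE mulr_suml; apply: eq_bigr => k _; rewrite mxE; ring.
  have term0 k : 0 <= ((H^T *m x) k 0 - r * x k 0) * v k 0.
    by rewrite mulr_ge0 ?(ltW (v0 k))// subr_ge0 (le_trans _ (ge k))// ler_wpM2r.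
  have Hx : H^T *m x = r *: x.
    apply/colP => k; rewrite [RHS]mxE; apply/eqP; rewrite -subr_eq0.
    move/eqP: pair; rewrite psumr_eq0// => /allP /(_ k (mem_index_enum _)) /=.
    by rewrite mulf_eq0 (gt_eqF (v0 k)) orbF.
  have xn0 : x != 0.
    apply: contraNneq wn0 => xe; apply/eqP/rowP => l; rewrite [RHS]mxE.
    by apply/eqP; rewrite -normr_eq0 -xl xe mxE.
  by have := irreducible_eigen_gt0 (irreducible_trmx Hirr) x0 xn0 Hx i; rewrite xi ltxx.
(* A monic polynomial without roots in [[r, +oo)] is positive at [r], by the intermediate value
   theorem. *)
have /monicP lcA := char_poly_monic A.
have [M MP] : exists M, forall y, M <= y -> lead_coef (char_poly A) <= (char_poly A).[y].
  by apply: poly_pinfty_gt_lc; rewrite lcA ltr01.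
rewrite ltNge; apply/negP => le0.
have [||y /andP[ry _] rooty] := @poly_ivt R (char_poly A) r (Num.max r M).
- by rewrite le_max lexx.
- by rewrite le0 (le_trans _ (MP _ _)) ?lcA ?ler01// le_max lexx orbT.
by have := noroot y ry; rewrite rooty.
Qed.

Lemma char_polyCE H : char_polyC H = map_poly (real_complex R) (char_poly H).
Proof. by rewrite map_char_poly. Qed.

(** For simplicity: a double root would annihilate the derivative of the characteristic polynomial
    at [r], but that derivative is a sum of characteristic polynomials of principal submatrices, all
    positive there. *)
Lemma pf_eig_exists H : (0 < n)%N -> irreducible_mx H -> exists r, is_pf_eig H r.
Proof.
move=> n0 Hirr; have [r [u [v [r0 v0 Hv u0 Hu]]]] := perron_pair n0 Hirr.
exists r; split=> //; last by exists u.
- rewrite /eigenvalueC char_polyCE -[(r%:C)%C]/(real_complex R r) fmorph_root.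
  rewrite -eigenvalue_root_char; apply/eigenvalueP; exists u^T.
    by rewrite -[H]trmxK -trmx_mul Hu linearZ.
  apply/eqP => /(congr1 (fun M : 'rV_n => M 0 (Ordinal n0))).
  by rewrite !mxE; apply/eqP; rewrite gt_eqF.
- apply/negP => /dvdpP[p pE].
  have : ((char_polyC H)^`()).[(r%:C)%C] = 0.
    rewrite pE expr2 mulrA derivM derivXsubC !(hornerXsubC, hornerD, hornerM, hornerC).
    by rewrite subrr !(mulr0, mul0r, addr0).
  rewrite char_polyCE -[(r%:C)%C]/(real_complex R r) deriv_map horner_map.
  move=> /eqP; rewrite fmorph_eq0 deriv_char_poly_minors horner_sum => /eqP.
  apply/eqP; rewrite gt_eqF// (bigD1 (Ordinal n0))//= ltr_pwDl ?(minor_char_poly_gt0 _ Hirr v0 Hv)//.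
  by rewrite sumr_ge0// => i _; rewrite ltW ?(minor_char_poly_gt0 _ Hirr v0 Hv).
- by exists v.
Qed.

End PerronFrobenius.

(** * Bounds for irreducible matrices *)

Section Spectrum.
Variables (R : realType) (n : nat).
Implicit Types (H M : 'M[R]_n) (S : {set 'I_n}).

Lemma re_sum (I : Type) (s : seq I) (F : I -> R[i]) :
  complex.Re (\sum_(i <- s) F i) = \sum_(i <- s) complex.Re (F i).
Proof. by apply: (big_morph (@complex.Re R)) => // -[? ?] [? ?]. Qed.

Lemma im_sum (I : Type) (s : seq I) (F : I -> R[i]) :
  complex.Im (\sum_(i <- s) F i) = \sum_(i <- s) complex.Im (F i).
Proof. by apply: (big_morph (@complex.Im R)) => // -[? ?] [? ?]. Qed.

(** For [w = a + i b] the real part of the inverse is [a / (a ^+ 2 + b ^+ 2)], at most [1 / a]. *)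
Lemma re_inv_le (w : R[i]) d : 0 < d -> d <= complex.Re w ->
  complex.Re w^-1 <= d^-1.
Proof.
case: w => a b d0 /= da; have a0 := lt_le_trans d0 da.
have ab0 : 0 < a ^+ 2 + b ^+ 2 by rewrite ltr_pwDl ?sqr_ge0// exprn_gt0.
by rewrite ler_pdivrMr// ler_pdivlMl//; nra.
Qed.

(** A left eigenvector is split into real and imaginary parts so that the real Cheeger inequality
    can be applied to each. *)
Lemma eigenvalueC_split H z : eigenvalueC H z ->
  exists a b : 'I_n -> R,
  [/\ exists i, 0 < a i ^+ 2 + b i ^+ 2,
   forall j, \sum_i a i * H i j = complex.Re z * a j - complex.Im z * b j &
   forall j, \sum_i b i * H i j = complex.Re z * b j + complex.Im z * a j].
Proof.
rewrite /eigenvalueC /char_polyC -eigenvalue_root_char => /eigenvalueP[w wH wn0].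
exists (fun i => complex.Re (w 0 i)), (fun i => complex.Im (w 0 i)); split.
- apply/existsP; apply: contraNT wn0; rewrite negb_exists => /forallP w0.
  apply/eqP/rowP => i; rewrite [RHS]mxE; move: (w0 i); case: (w 0 i) => a b /=.
  rewrite -leNgt => le0; have := sqr_ge0 a; have := sqr_ge0 b => b0 a0.
  have /eqP : a ^+ 2 = 0 by lra.
  have /eqP : b ^+ 2 = 0 by lra.
  by rewrite !sqrf_eq0 => /eqP -> /eqP ->.
- move=> j; move/rowP: wH => /(_ j); rewrite !mxE => /(congr1 (@complex.Re R)).
  rewrite re_sum; under eq_bigr do rewrite mxE.
  case: z (w 0 j) => x y [a b] /= <-; apply: eq_bigr => i _.
  by case: (w 0 i) => c d /=; rewrite mulr0 subr0.
- move=> j; move/rowP: wH => /(_ j); rewrite !mxE => /(congr1 (@complex.Im R)).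
  rewrite im_sum; under eq_bigr do rewrite mxE.
  case: z (w 0 j) => x y [a b] /= <-; apply: eq_bigr => i _.
  by case: (w 0 i) => c d /=; rewrite mulr0 add0r.
Qed.

(** Simplicity of [r] is what excludes it from the remaining roots. *)
Lemma pf_spectrum H r : is_pf_eig H r ->
  exists rs : seq R[i],
  [/\ char_polyC H = \prod_(z <- (r%:C)%C :: rs) ('X - z%:P), size rs = n.-1 &
      (r%:C)%C \notin rs].
Proof.
move=> [r0 rootr simpler _ _].
have [rs0 rs0E] := closed_field_poly_normal (char_polyC H).
have lc1 : lead_coef (char_polyC H) = 1 by apply/monicP/char_poly_monic.
rewrite lc1 scale1r in rs0E.
have rrs0 : (r%:C)%C \in rs0 by rewrite -root_prod_XsubC -rs0E.
have prs := perm_to_rem rrs0; set rs := rem _ _ in prs.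
have E : char_polyC H = \prod_(z <- (r%:C)%C :: rs) ('X - z%:P).
  by rewrite rs0E (perm_big _ prs).
exists rs; split=> //.
  have := size_char_poly (map_mx (fun x : R => (x%:C)%C) H).
  by rewrite -/(char_polyC H) E size_prod_XsubC /= => -[<-].
apply: contraNN simpler; rewrite E big_cons => rrs.
by rewrite expr2 dvdp_mul2l ?polyXsubC_eq0// dvdp_XsubCl root_prod_XsubC.
Qed.

Lemma pf_other_eigenvalue H r : (2 <= n)%N -> is_pf_eig H r ->
  exists z, eigenvalueC H z /\ z <> (r%:C)%C.
Proof.
move=> n2 /pf_spectrum[rs [E size_rs]].
have : (0 < size rs)%N by rewrite size_rs -ltnS prednK// (ltn_trans _ n2).
case: rs E {size_rs} => // z rs E _; rewrite inE negb_or => /andP[zr _]; exists z; split.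
  by rewrite /eigenvalueC E root_prod_XsubC !inE eqxx orbT.
by move=> zE; rewrite zE eqxx in zr.
Qed.

(** The trace is the sum of [(b - z)^-1] over the spectrum, by comparing two formulas for a
    logarithmic derivative; the Perron root gives the first term, and [re_inv_le] bounds the [n.-1]
    others. *)
Lemma trace_resolvent_le H M r b rho : is_pf_eig H r -> r < b -> rho < b ->
  (forall z, eigenvalueC H z -> z <> (r%:C)%C -> complex.Re z <= rho) ->
  (b%:M - H) *m M = 1%:M -> \tr M <= (b - r)^-1 + n.-1%:R * (b - rho)^-1.
Proof.
move=> pfr rb rhob rho_max BM.
have [rs [E size_rs rNrs]] := pf_spectrum pfr.
have re_rs z : z \in rs -> complex.Re z <= rho.
  move=> zrs; apply: rho_max; first by rewrite /eigenvalueC E root_prod_XsubC inE zrs orbT.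
  by move=> zr; rewrite -zr zrs in rNrs.
have bNrs : (b%:C)%C \notin (r%:C)%C :: rs.
  rewrite inE negb_or; apply/andP; split.
    by apply/eqP => -[br]; rewrite br ltxx in rb.
  by apply/negP => /re_rs /=; rewrite leNgt rhob.
have detn0 : (char_polyC H).[(b%:C)%C] != 0.
  by rewrite -[_ == 0]/(root _ _) E root_prod_XsubC.
have trE : ((\tr M)%:C)%C = \sum_(z <- (r%:C)%C :: rs) ((b%:C)%C - z)^-1.
  apply: (mulfI detn0); rewrite [RHS](_ : _ = ((char_polyC H)^`()).[(b%:C)%C]); last first.
    by rewrite E log_deriv_prod_XsubC.
  have := congr1 (real_complex R) (trace_resolvent BM).
  by rewrite rmorphM -!horner_map -deriv_map -!char_polyCE.
have := congr1 (@complex.Re R) trE; rewrite re_sum big_cons -[LHS]/(\tr M) => ->.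
apply: lerD.
  by apply: re_inv_le; rewrite ?subr_gt0//=.
rewrite -size_rs mulr_natl (big_nth 0) big_mkord.
rewrite -[X in _ <= _ *+ X]card_ord -sumr_const; apply: ler_sum => i _; apply: re_inv_le; first by rewrite subr_gt0.
have := re_rs _ (mem_nth 0 (ltn_ord i)).
by case: (rs`_i) => x y /=; rewrite lerD2l lerN2.
Qed.

End Spectrum.

(** * The two inequalities for an irreducible matrix *)

Section IrreducibleBounds.
Variables (R : realType) (n : nat) (H : 'M[R]_n).
Hypotheses (n_ge2 : (2 <= n)%N) (Hirr : irreducible_mx H).

Let r := pf_eig H.
Let u (i : 'I_n) : R := pf_left H i 0.
Let v (i : 'I_n) : R := pf_right H i 0.
Let p i := u i * v i.
Let q i j := u i * H i j * v j / r.

Let n_gt0 : (0 < n)%N. Proof. exact: leq_trans n_ge2. Qed.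

Lemma pf_eigP : is_pf_eig H r.
Proof. exact: (xgetPex 0 (pf_eig_exists n_gt0 Hirr)). Qed.

Lemma pf_eig_gt0 : 0 < r. Proof. by have [] := pf_eigP. Qed.

Lemma pf_rightP : (forall i, 0 < v i) /\ H *m pf_right H = r *: pf_right H.
Proof.
have [_ _ _ px _] := pf_eigP.
have := @xgetPex _ 0 [set x : 'cV[R]_n | (forall i, 0 < x i 0) /\ H *m x = r *: x]%classic px.
by [].
Qed.

Lemma pf_leftP : (forall i, 0 < u i) /\ H^T *m pf_left H = r *: pf_left H.
Proof.
have [_ _ _ _ px] := pf_eigP.
have := @xgetPex _ 0 [set x : 'cV[R]_n | (forall i, 0 < x i 0) /\ H^T *m x = r *: x]%classic px.
by [].
Qed.

Let v_gt0 : forall i, 0 < v i. Proof. by have [] := pf_rightP. Qed.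
Let u_gt0 : forall i, 0 < u i. Proof. by have [] := pf_leftP. Qed.
Let p_gt0 : forall i, 0 < p i. Proof. by move=> i; rewrite mulr_gt0. Qed.
Let r_neq0 : r != 0. Proof. by rewrite gt_eqF ?pf_eig_gt0. Qed.

Let q_ge0 i j : 0 <= q i j.
Proof.
have [H0 _] := Hirr.
by rewrite /q !mulr_ge0 ?invr_ge0 ?(ltW pf_eig_gt0) ?(ltW (u_gt0 _)) ?(ltW (v_gt0 _)).
Qed.

Let q_row i : \sum_j q i j = p i.
Proof.
have [_ /colP/(_ i)] := pf_rightP; rewrite mxE [RHS]mxE -/(v i) => Hv.
transitivity (u i / r * \sum_j H i j * v j).
  by rewrite mulr_sumr; apply: eq_bigr => j _; rewrite /q; ring.
by rewrite Hv /p; field.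
Qed.

Let q_col j : \sum_i q i j = p j.
Proof.
have [_ /colP/(_ j)] := pf_leftP; rewrite mxE [RHS]mxE -/(u j) => Hu.
transitivity (v j / r * \sum_i H^T j i * u i).
  by rewrite mulr_sumr; apply: eq_bigr => i _; rewrite /q mxE; ring.
by rewrite Hu /p; field.
Qed.

Lemma phi_SE (S : {set 'I_n}) :
  phi_S H S = (\sum_(i in S) \sum_(j in ~: S) q i j) / \sum_(i in S) p i.
Proof.
rewrite /phi_S -/r.
have -> : \sum_(i in S) \sum_j u i * H i j * v j = r * \sum_(i in S) p i.
  rewrite mulr_sumr; apply: eq_bigr => i _; rewrite -q_row mulr_sumr.
  by apply: eq_bigr => j _; rewrite /q; field.
have -> : \sum_(i in S) \sum_(j in ~: S) u i * H i j * v j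
    = r * \sum_(i in S) \sum_(j in ~: S) q i j.
  rewrite mulr_sumr; apply: eq_bigr => i _; rewrite mulr_sumr.
  by apply: eq_bigr => j _; rewrite /q; field.
by rewrite -mulf_div mulfV// mul1r.
Qed.

Let p_sum_gt0 (S : {set 'I_n}) : S != finset.set0 -> 0 < \sum_(i in S) p i.
Proof.
move=> /finset.set0Pn[i iS]; rewrite (bigD1 i)//= ltr_pwDl// sumr_ge0// => j _.
exact: ltW.
Qed.

Lemma phi_S_ge0 (S : {set 'I_n}) : 0 <= phi_S H S.
Proof.
rewrite phi_SE divr_ge0// sumr_ge0// => i _; last exact: ltW.
by rewrite sumr_ge0.
Qed.

Lemma phi_S_le1 (S : {set 'I_n}) : phi_S H S <= 1.
Proof.
have [->|S0] := eqVneq S finset.set0.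
  by rewrite phi_SE [X in X / _]big1 ?mul0r ?ler01// => i; rewrite inE.
rewrite phi_SE ler_pdivrMr ?p_sum_gt0// mul1r; apply: ler_sum => i _.
by rewrite -q_row [leRHS](bigID (mem (~: S))) /= lerDl sumr_ge0.
Qed.

(** The lighter of two singletons has at most half the mass. Thus the infimum in [edge_expansion] is
    over a nonempty set. *)
Lemma small_set_exists : exists S : {set 'I_n}, S != finset.set0 /\
  \sum_(i in S) p i <= 2^-1 * \sum_i p i.
Proof.
pose i0 : 'I_n := Ordinal n_gt0; pose i1 : 'I_n := Ordinal n_ge2.
have : p i0 + p i1 <= \sum_i p i.
  by rewrite (bigD1 i0)//= (bigD1 i1)//= addrA lerDl sumr_ge0// => i _; rewrite ltW.
have S0 i : [set i]%SET != finset.set0 by apply/finset.set0Pn; exists i; rewrite inE.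
have [le01|lt10] := leP (p i0) (p i1).
  by exists [set i0]%SET; split; rewrite ?big_set1//; lra.
by exists [set i1]%SET; split; rewrite ?big_set1//; lra.
Qed.

Lemma edge_expansion_le S : S != finset.set0 ->
  \sum_(i in S) p i <= 2^-1 * \sum_i p i -> edge_expansion H <= phi_S H S.
Proof.
move=> S0 leS; apply: ge_inf; last by exists S.
by exists 0 => _ [T _ <-]; exact: phi_S_ge0.
Qed.

Lemma le_edge_expansion x : (forall S : {set 'I_n}, S != finset.set0 ->
  \sum_(i in S) p i <= 2^-1 * \sum_i p i -> x <= phi_S H S) ->
  x <= edge_expansion H.
Proof.
move=> xle; apply: lb_le_inf; last by move=> _ [S [S0 leS] <-]; exact: xle.
by have [S SP] := small_set_exists; exists (phi_S H S), S.
Qed.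

Lemma edge_expansion_ge0 : 0 <= edge_expansion H.
Proof. by apply: le_edge_expansion => S _ _; exact: phi_S_ge0. Qed.

Lemma edge_expansion_le1 : edge_expansion H <= 1.
Proof.
have [S [S0 leS]] := small_set_exists.
exact: le_trans (edge_expansion_le S0 leS) (phi_S_le1 S).
Qed.

(** [f + i g] is a left eigenvector divided by the left Perron vector. Both parts have mean zero, so
    Cheeger's inequality applies to each; in the sum of the two bounds the imaginary part of [z]
    cancels. *)
Lemma edge_expansion_eigenvalue z : eigenvalueC H z -> z <> (r%:C)%C ->
  edge_expansion H ^+ 2 / 2 <= 1 - complex.Re z / r.
Proof.
move=> /eigenvalueC_split[a [b [[i0 ab0] aH bH]]] zr.
set x := complex.Re z in aH bH *; set y := complex.Im z in aH bH *.
pose f i := a i / u i; pose g i := b i / u i.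
have af i : a i = u i * f i by rewrite /f mulrCA mulfV ?mulr1// gt_eqF.
have bg i : b i = u i * g i by rewrite /g mulrCA mulfV ?mulr1// gt_eqF.
have qf j : \sum_i q i j * f i = p j * (x / r * f j - y / r * g j).
  transitivity (v j / r * \sum_i a i * H i j).
    by rewrite mulr_sumr; apply: eq_bigr => i _; rewrite /q af; ring.
  by rewrite aH af bg /p; ring.
have qg j : \sum_i q i j * g i = p j * (x / r * g j + y / r * f j).
  transitivity (v j / r * \sum_i b i * H i j).
    by rewrite mulr_sumr; apply: eq_bigr => i _; rewrite /q bg; ring.
  by rewrite bH af bg /p; ring.
set A := \sum_i p i * f i; set B := \sum_i p i * g i.
have eA : A = x / r * A - y / r * B.
  rewrite {1}/A -(flow_sum_row q_row) exchange_big /=; under eq_bigr do rewrite qf.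
  by rewrite /A /B !mulr_sumr -sumrB; apply: eq_bigr => j _; ring.
have eB : B = x / r * B + y / r * A.
  rewrite {1}/B -(flow_sum_row q_row) exchange_big /=; under eq_bigr do rewrite qg.
  by rewrite /A /B !mulr_sumr -big_split; apply: eq_bigr => j _ /=; ring.
(* This is [|1 - z / r| ^+ 2]; since [eA] and [eB] say [(1 - z / r) (A + i B) = 0], both means
   vanish. *)
have m0 : 0 < (1 - x / r) ^+ 2 + (y / r) ^+ 2.
  rewrite lt0r addr_ge0 ?sqr_ge0// andbT paddr_eq0 ?sqr_ge0// !sqrf_eq0.
  apply/negP => /andP[/eqP xr /eqP yr]; apply: zr.
  have xE : x = r by rewrite -[x](divfK r_neq0) (_ : x / r = 1) ?mul1r//; lra.
  have yE : y = 0 by rewrite -[y](divfK r_neq0) yr mul0r.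
  by move: xE yE; rewrite /x /y; case: (z) => ? ? /= -> ->.
have A0 : A = 0.
  apply/eqP; rewrite -(mulrI_eq0 _ (mulfI (lt0r_neq0 m0))); apply/eqP.
  have e1 : (1 - x / r) * A + y / r * B = 0 by lra.
  have e2 : (1 - x / r) * B - y / r * A = 0 by lra.
  transitivity ((1 - x / r) * ((1 - x / r) * A + y / r * B)
    - y / r * ((1 - x / r) * B - y / r * A)); first by ring.
  by rewrite e1 e2 !mulr0 subr0.
have B0 : B = 0.
  apply/eqP; rewrite -(mulrI_eq0 _ (mulfI (lt0r_neq0 m0))); apply/eqP.
  have e1 : (1 - x / r) * A + y / r * B = 0 by lra.
  have e2 : (1 - x / r) * B - y / r * A = 0 by lra.
  transitivity (y / r * ((1 - x / r) * A + y / r * B)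
    + (1 - x / r) * ((1 - x / r) * B - y / r * A)); first by ring.
  by rewrite e1 e2 !mulr0 addr0.
have expand (S : {set 'I_n}) : S != finset.set0 ->
    \sum_(i in S) p i <= 2^-1 * \sum_i p i ->
    edge_expansion H * \sum_(i in S) p i <= \sum_(i in S) \sum_(j in ~: S) q i j.
  by move=> S0 /(edge_expansion_le S0); rewrite phi_SE ler_pdivlMr// p_sum_gt0.
have cf := cheeger_inequality q_ge0 q_row q_col edge_expansion_ge0 expand A0.
have cg := cheeger_inequality q_ge0 q_row q_col edge_expansion_ge0 expand B0.
set N := \sum_i p i * f i ^+ 2 + \sum_i p i * g i ^+ 2.
have N0 : 0 < N.
  rewrite /N -big_split (bigD1 i0)//= ltr_pwDl//.
    rewrite -mulrDr mulr_gt0//; move: ab0; rewrite af bg !exprMn -mulrDr pmulr_rgt0//.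
    by rewrite exprn_gt0.
  by rewrite sumr_ge0// => i _; rewrite addr_ge0// mulr_ge0 ?sqr_ge0// ltW.
have cross : \sum_i \sum_j q i j * (f i * f j) + \sum_i \sum_j q i j * (g i * g j)
    = x / r * N.
  transitivity (\sum_j (\sum_i q i j * f i) * f j + \sum_j (\sum_i q i j * g i) * g j).
    by congr (_ + _); rewrite exchange_big /=; apply: eq_bigr => j _;
      rewrite mulr_suml; apply: eq_bigr => i _; ring.
  rewrite /N -!big_split mulr_sumr; apply: eq_bigr => j _ /=.
  by rewrite qf qg; ring.
rewrite -(ler_pM2r N0) {1}/N mulrDr; apply: le_trans (lerD cf cg) _.
rewrite !(dirichletE q_row q_col) mulrBl mul1r -cross /N; lra.
Qed.

(** Dominance of the Perron root follows from [edge_expansion_eigenvalue], whose left side is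
    nonnegative; it bounds the set defining [re_lambda2] from above. *)
Lemma re_eigenvalue_le z : eigenvalueC H z -> z <> (r%:C)%C -> complex.Re z <= r.
Proof.
move=> ez zr; have := edge_expansion_eigenvalue ez zr.
have := sqr_ge0 (edge_expansion H); set e := _ ^+ 2 => e0 le.
have : complex.Re z / r <= 1 by lra.
by rewrite ler_pdivrMr ?pf_eig_gt0// mul1r.
Qed.

Lemma le_re_lambda2 z : eigenvalueC H z -> z <> (r%:C)%C ->
  complex.Re z <= re_lambda2 H.
Proof.
move=> ez zr; apply: ub_le_sup; last by exists z.
by exists r => _ [w [ew wr] <-]; exact: re_eigenvalue_le.
Qed.

Lemma edge_expansion_le_gap : edge_expansion H ^+ 2 / 2 <= spectral_gap H.
Proof.
rewrite /spectral_gap lerBrDr -lerBrDl ler_pdivrMr ?pf_eig_gt0//.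
apply: ge_sup.
  have [z zP] := pf_other_eigenvalue n_ge2 pf_eigP.
  by exists (complex.Re z), z.
move=> _ [z [ez zr] <-]; rewrite -ler_pdivrMr ?pf_eig_gt0//.
have := edge_expansion_eigenvalue ez zr; rewrite -/r; lra.
Qed.

Lemma spectral_gap_ge0 : 0 <= spectral_gap H.
Proof. by apply: le_trans edge_expansion_le_gap; rewrite divr_ge0 ?sqr_ge0. Qed.

Lemma gap_le_edge_expansion : spectral_gap H / (15 * n%:R) <= edge_expansion H.
Proof.
apply: le_edge_expansion => S S0 leS.
(* A zero gap is settled first, as the choice of [s] divides by [D]. *)
have := spectral_gap_ge0; set D := spectral_gap H; rewrite le0r => /orP[/eqP ->|D0].
  by rewrite mul0r phi_S_ge0.
pose m : R := n.-1%:R; pose rho := re_lambda2 H.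
have mE : n%:R = m + 1 :> R by rewrite /m natr1 prednK.
have m1 : 1 <= m by rewrite ler1n -ltnS prednK.
(* With this [s], [1 + s * D = 1 + 2 * m], so the [m] other eigenvalues add at most
   [m / (1 + 2 * m) <= 1 / 2] to the trace of [K]. *)
pose s := 2 * m / D.
have s0 : 0 < s by rewrite divr_gt0//; lra.
(* Chosen so that [b - H] is [r / s] times [1 + s (1 - H / r)]. *)
pose b := r + r / s.
have r0 : 0 < r := pf_eig_gt0.
have rs0 : 0 < r / s by rewrite divr_gt0.
have rb : r < b by rewrite /b ltrDl.
have rhoE : rho = r - r * D by rewrite /D /spectral_gap -/rho -/r; field.
have rhob : rho < b by rewrite rhoE (lt_trans _ rb)// gtrBl mulr_gt0.
have Bunit : b%:M - H \in unitmx.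
  rewrite unitmxE unitfE; apply/negP => detb.
  have eb : eigenvalueC H (b%:C)%C.
    rewrite /eigenvalueC char_polyCE -[(b%:C)%C]/(real_complex R b) fmorph_root.
    by rewrite /root horner_char_poly.
  have /(re_eigenvalue_le eb) : (b%:C)%C <> (r%:C)%C by move=> -[br]; rewrite br ltxx in rb.
  by rewrite /= leNgt rb.
pose M := invmx (b%:M - H).
have BM : (b%:M - H) *m M = 1%:M by rewrite mulmxV.
have trM := trace_resolvent_le pf_eigP rb rhob le_re_lambda2 BM.
(* Conjugation by the diagonal matrix of [v] turns [H / r] into the stochastic matrix [q i j / p i]
   and preserves traces. *)
pose K i j := r / s * (M i j * v j / v i).
have KP i j : (1 + s) * (p i * K i j) - s * \sum_k q i k * K k j = p i * (i == j)%:R.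
  have /matrixP/(_ i j) := BM; rewrite mulmxBl mul_scalar_mx !mxE => BMij.
  transitivity (u i * v j * (b * M i j - \sum_k H i k * M k j)).
    rewrite mulrBr; congr (_ - _).
      by rewrite /p /K /b; field; rewrite !gt_eqF.
    rewrite !mulr_sumr; apply: eq_bigr => k _; rewrite /q /K; field.
    by rewrite !gt_eqF.
  rewrite BMij /p; case: eqVneq => [->|_] //; by rewrite !mulr0.
have trK : \sum_i K i i = r / s * \tr M.
  rewrite mulr_sumr; apply: eq_bigr => i _; rewrite /K; congr (_ * _).
  by rewrite mulfK// gt_eqF.
have trK_le : \sum_i K i i <= 3 / 2.
  rewrite trK -(ler_pM2l rs0) in trM *; apply: le_trans trM _.
  have -> : b - r = r / s by rewrite /b; ring.
  have -> : b - rho = r / s * (1 + 2 * m).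
    by rewrite /b rhoE /s; field; rewrite !gt_eqF//; lra.
  have -> : r / s * ((r / s)^-1 + n.-1%:R * (r / s * (1 + 2 * m))^-1) = 1 + m / (1 + 2 * m).
    by rewrite -/m; field; rewrite !gt_eqF//; lra.
  have : m / (1 + 2 * m) <= 1 / 2 by rewrite ler_pdivrMr; lra.
  lra.
have cut := resolvent_trace_cut q_ge0 q_row q_col p_gt0 (ltW s0) KP S0 leS.
have pS0 := p_sum_gt0 S0.
rewrite phi_SE ler_pdivlMr// -(ler_pM2l (mulr_gt0 (ltr0n R 2) s0)).
apply: le_trans cut.
have : 1 / 2 * \sum_(i in S) p i <= (2 - \sum_i K i i) * \sum_(i in S) p i.
  by rewrite ler_pM2r//; lra.
(* What remains is [4 * m / (15 * (m + 1)) <= 1 / 2], which holds with room to spare. *)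
apply: le_trans; rewrite mulrA ler_pM2r// mE.
rewrite (_ : 2 * s * (D / (15 * (m + 1))) = 4 * m / (15 * (m + 1))); last first.
  by rewrite /s; field; rewrite !gt_eqF//; lra.
by rewrite ler_pdivrMr; lra.
Qed.

End IrreducibleBounds.

(** * Extension to nonnegative matrices *)

Section Extension.
Variables (R : realType) (n : nat) (A : 'M[R]_n).
Hypotheses (n_ge2 : (2 <= n)%N) (A_ge0 : nonneg_mx A).

(** Adding [eps / n] to each of the [n ^ 2] entries makes the matrix positive, hence irreducible
    with exponent [1], at Frobenius distance exactly [eps]. *)
Lemma nbhd_irr_nonempty eps : 0 < eps -> (nbhd_irr A eps !=set0)%classic.
Proof.
move=> eps0; have n0 : 0 < n%:R :> R by rewrite ltr0n (leq_trans _ n_ge2).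
have d0 : 0 < eps / n%:R by rewrite divr_gt0.
have gt0 i j : 0 < (A + const_mx (eps / n%:R)) i j by rewrite !mxE ltr_wpDl.
exists (A + const_mx (eps / n%:R)); split.
  split=> [i j|s t]; first exact: ltW.
  by exists 1%N; rewrite expr1.
rewrite /frob_norm.
under eq_bigr => i _ do under eq_bigr => j _ do rewrite !mxE opprD addNKr sqrrN.
rewrite !sumr_const card_ord (_ : _ *+ n *+ n = eps ^+ 2).
  by rewrite sqrtr_sqr gtr0_norm.
by rewrite -mulrnA -[LHS]mulr_natr natrM; field; rewrite gt_eqF.
Qed.

(** * Infima over shrinking neighbourhoods and their limit *)

Section Infimum.
Variables (g : 'M[R]_n -> R) (C : R).
Hypothesis g_ge0 : forall H, irreducible_mx H -> 0 <= g H.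
Hypothesis g_le : forall H, irreducible_mx H -> g H <= C.

(** The common form of the functions whose right limits at zero are [spectral_gap_ext] and
    [edge_expansion_ext]. *)
Definition inf_near eps := inf [set g H | H in nbhd_irr A eps]%classic.

Lemma inf_near_le eps H : nbhd_irr A eps H -> inf_near eps <= g H.
Proof.
move=> HA; apply: ge_inf; last by exists H.
by exists 0 => _ [H' [H'irr _] <-]; exact: g_ge0.
Qed.

Lemma le_inf_near eps x : 0 < eps ->
  (forall H, nbhd_irr A eps H -> x <= g H) -> x <= inf_near eps.
Proof.
move=> eps0 xle; apply: lb_le_inf; last by move=> _ [H HA <-]; exact: xle.
by have [H HA] := nbhd_irr_nonempty eps0; exists (g H), H.
Qed.

Lemma inf_near_ge0 eps : 0 < eps -> 0 <= inf_near eps.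
Proof. by move=> eps0; apply: le_inf_near => // H [Hirr _]; exact: g_ge0. Qed.

(** Larger neighbourhoods have smaller infima, so [inf_near] is nonincreasing on positive [eps], and
    it is bounded above by [C]; hence [lim] is a genuine limit. *)
Lemma inf_near_cvg : cvg (inf_near x @[x --> 0^'+])%classic.
Proof.
apply: nonincreasing_at_right_is_cvgr; apply: nearW => x.
  move=> a b; rewrite !in_itv /= => /andP[a0 _] /andP[b0 _] ba.
  apply: le_inf_near => // H [Hirr HA]; apply: inf_near_le; split=> //.
  exact: le_trans HA ba.
exists C => _ [a + <-]; rewrite /= in_itv /= => /andP[a0 _].
have [H HA] := nbhd_irr_nonempty a0.
by apply: le_trans (inf_near_le HA) _; apply: g_le; case: HA.
Qed.

End Infimum.
End Extension.

Theorem theorem1p1 (R : realType) (n : nat) (hn : (2 <= n)%N)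
    (A : 'M[R]_n) (hA : nonneg_mx A) :
  spectral_gap_ext A / (15 * n%:R) <= edge_expansion_ext A /\
  edge_expansion_ext A <= Num.sqrt (2 * spectral_gap_ext A).
Proof.
have n0 : 0 < 15 * n%:R :> R by rewrite mulr_gt0 ?ltr0n// (leq_trans _ hn).
pose F := inf_near A (@spectral_gap R n); pose G := inf_near A (@edge_expansion R n).
have gap_ge0 (H : 'M[R]_n) : irreducible_mx H -> 0 <= spectral_gap H by apply: spectral_gap_ge0.
have phi_ge0 (H : 'M[R]_n) : irreducible_mx H -> 0 <= edge_expansion H by apply: edge_expansion_ge0.
(* The lower bound on the expansion, itself at most [1], also supplies the upper bound on the gap
   needed for convergence. *)
have gap_le (H : 'M[R]_n) : irreducible_mx H -> spectral_gap H <= 15 * n%:R.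
  move=> Hirr; rewrite -[leRHS]mul1r -ler_pdivrMr//.
  exact: le_trans (gap_le_edge_expansion hn Hirr) (edge_expansion_le1 hn Hirr).
have cF : (F x @[x --> 0^'+] --> spectral_gap_ext A)%classic.
  by have := inf_near_cvg hn hA gap_ge0 gap_le.
have cG : (G x @[x --> 0^'+] --> edge_expansion_ext A)%classic.
  by have := inf_near_cvg hn hA phi_ge0 (fun H => @edge_expansion_le1 R n H hn).
have FG eps : 0 < eps -> F eps / (15 * n%:R) <= G eps.
  move=> eps0; apply: le_inf_near => // H HA; have [Hirr _] := HA.
  apply: le_trans (gap_le_edge_expansion hn Hirr).
  by rewrite ler_pM2r ?invr_gt0//; exact: inf_near_le.
(* The squared form passes to the limit by continuity of multiplication; the square root is taken
   only at the end. *)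
have GF eps : 0 < eps -> G eps * G eps <= 2 * F eps.
  move=> eps0; rewrite -ler_pdivrMl ?ltr0n//; apply: le_inf_near => // H HA.
  have [Hirr _] := HA; apply: le_trans (edge_expansion_le_gap hn Hirr).
  rewrite mulrC ler_pM2r ?invr_gt0 ?ltr0n// -expr2 ler_pXn2r ?nnegrE ?phi_ge0//.
    exact: inf_near_le.
  exact: inf_near_ge0.
split.
  apply: ler_cvg_to (cvgMr_tmp cF) cG _; near=> x; apply: FG.
  by near: x; exact: nbhs_right_gt.
have GF_ext : edge_expansion_ext A * edge_expansion_ext A <= 2 * spectral_gap_ext A.
  apply: ler_cvg_to (cvgM cG cG) (cvgMl_tmp cF) _; near=> x; apply: GF.
  by near: x; exact: nbhs_right_gt.
by apply: le_trans (ler_norm _) _; rewrite -sqrtr_sqr ler_wsqrtr// expr2.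
Unshelve. all: by end_near. Qed.
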